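(* Let $w$ be a positive integer with binary representation $b_1b_2\cdots b_n$ (so $n$ is the binary size of $w$). The algorithm Encode\_W-to-SIP (described in the context) encodes $w$ in a self-inverting permutation $\pi^*$ of $\{1,2,\ldots,2n+1\}$, and it runs in $O(n)$ time and $O(n)$ space.
   Context: A permutation $\pi=(\pi_1,\ldots,\pi_m)$ of $\{1,\ldots,m\}$ is self-inverting (an involution) if $\pi_{\pi_i}=i$ for all $i$, equivalently all its cycles have length 1 or 2. For a binary string $B=b_1\cdots b_k$, $\mathrm{flip}(B)$ is the string obtained by complementing every bit; $B_1\|B_2$ denotes concatenation. Algorithm Encode\_W-to-SIP, on input $w$: (1) compute the binary representation $B=b_1\cdots b_n$ of $w$; (2) form $B'=0^n\|B\|1$ (length $n'=2n+1$) and let $B^*$ be the bit sequence of $\mathrm{flip}(B')$; (3) let $X=(x_1<\cdots<x_k)$ be the positions of the 0's of $B^*$ and $Y=(y_1<\cdots<y_m)$ the positions of the 1's of $B^*$; (4) form the bitonic sequence $\pi^b=(x_1,\ldots,x_k,y_m,y_{m-1},\ldots,y_1)$, a permutation of $\{1,\ldots,n'\}$; write $\pi^b=(\pi^b_1,\ldots,\pi^b_{n'})$; (5) for $i=1,\ldots,n$ form the 2-cycle $(\pi^b_i,\pi^b_{n'+1-i})$, and form the 1-cycle $(\pi^b_{n+1})$; (6)–(8) output the permutation $\pi^*$ of $\{1,\ldots,n'\}$ whose cycles are exactly these cycles, i.e. $\pi^*_{\pi^b_i}=\pi^b_{n'+1-i}$ and $\pi^*_{\pi^b_{n'+1-i}}=\pi^b_i$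 for $1\le i\le n$, and $\pi^*_{\pi^b_{n+1}}=\pi^b_{n+1}$. *)

(* Defs.v *)
From mathcomp Require Import all_boot.

Set Implicit Arguments.
Unset Strict Implicit.
Unset Printing Implicit Defensive.

(* Permutations and bit strings are in one-line notation and indexed from 1:
   [item p i] is the paper-style p_i. *)
Definition item (p : seq nat) (i : nat) : nat := nth 0 p i.-1.

Definition self_inverting_perm (m : nat) (p : seq nat) : Prop :=
  perm_eq p (iota 1 m) /\ forall i, 1 <= i <= m -> item p (item p i) = i.

(* Most significant bit first, without leading zeros. *)
Definition binary_repr (w : nat) (B : seq bool) : Prop :=
  head false B /\
  w = \sum_(i < size B) nth false B i * 2 ^ (size B - i.+1).

Definition flip (B : seq bool) : seq bool := map negb B.

Definition padded (B : seq bool) : seq bool :=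
  nseq (size B) false ++ B ++ [:: true].

Definition positions (v : bool) (S : seq bool) : seq nat :=
  [seq i <- iota 1 (size S) | nth false S i.-1 == v].

Definition bitonic (S : seq bool) : seq nat :=
  positions false S ++ rev (positions true S).

(* [p] is the permutation whose cycles pair the i-th item of [pb] from the left
   with the i-th item from the right, the middle item being a fixed point. *)
Definition has_cycles (n : nat) (pb p : seq nat) : Prop :=
  [/\ size p = 2 * n + 1,
      forall i, 1 <= i <= n ->
        item p (item pb i) = item pb (2 * n + 1 + 1 - i) /\
        item p (item pb (2 * n + 1 + 1 - i)) = item pb i
    & item p (item pb n.+1) = item pb n.+1].

Definition encoding_of (B : seq bool) (p : seq nat) : Prop :=
  has_cycles (size B) (bitonic (flip (padded B))) p.

(* A unit-cost RAM: registers and heap-allocated arrays (indexed from 0), both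
   named by naturals and holding naturals; an absent register or cell reads as 0.
   The arithmetic is restricted to +, truncated -, halving and parity, so that
   unit cost is not abused. *)
Inductive expr : Type :=
| Cst of nat
| Reg of nat
| Cell of nat & expr
| Add of expr & expr
| Sub of expr & expr
| Half of expr
| Odd of expr.

Inductive cmd : Type :=
| Skip
| Set_ of nat & expr
| Store of nat & expr & expr
| New of nat & expr
| Seq of cmd & cmd
| If of expr & cmd & cmd
| While of expr & cmd.

Record state : Type := State { regs : seq nat; heap : seq (seq nat) }.

Definition array (st : state) (a : nat) : seq nat := nth [::] (heap st) a.

Fixpoint eval (st : state) (e : expr) : nat :=
  match e with
  | Cst k => k
  | Reg x => nth 0 (regs st) x
  | Cell a e1 => nth 0 (array st a) (eval st e1)
  | Add e1 e2 => eval st e1 + eval st e2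
  | Sub e1 e2 => eval st e1 - eval st e2
  | Half e1 => (eval st e1)./2
  | Odd e1 => odd (eval st e1)
  end.

Fixpoint ecost (e : expr) : nat :=
  match e with
  | Cst _ | Reg _ => 1
  | Cell _ e1 | Half e1 | Odd e1 => (ecost e1).+1
  | Add e1 e2 | Sub e1 e2 => (ecost e1 + ecost e2).+1
  end.

Definition set_reg (st : state) (x v : nat) : state :=
  State (set_nth 0 (regs st) x v) (heap st).

Definition set_array (st : state) (a : nat) (s : seq nat) : state :=
  State (regs st) (set_nth [::] (heap st) a s).

(* Number of words in use: the registers, and for each array its cells and one
   descriptor word. *)
Definition space (st : state) : nat :=
  size (regs st) + sumn [seq (size s).+1 | s <- heap st].

(* [exec c st st' t s]: from [st], [c] halts in [st'] after [t] elementary steps,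
   [s] being the peak of [space] over all states traversed.  Writing outside an
   array has no rule, so the machine is stuck; [New] clears the array it
   allocates and pays for each cell. *)
Inductive exec : cmd -> state -> state -> nat -> nat -> Prop :=
| ExecSkip st : exec Skip st st 1 (space st)
| ExecSet x e st :
    let st' := set_reg st x (eval st e) in
    exec (Set_ x e) st st' (ecost e).+1 (maxn (space st) (space st'))
| ExecStore a e1 e2 st :
    eval st e1 < size (array st a) ->
    let st' :=
      set_array st a (set_nth 0 (array st a) (eval st e1) (eval st e2)) in
    exec (Store a e1 e2) st st' (ecost e1 + ecost e2).+1
         (maxn (space st) (space st'))
| ExecNew a e st :
    let st' := set_array st a (nseq (eval st e) 0) in
    exec (New a e) st st' (ecost e + eval st e).+1
         (maxn (space st) (space st'))
| ExecSeq c1 c2 st1 st2 st3 t1 t2 s1 s2 :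
    exec c1 st1 st2 t1 s1 -> exec c2 st2 st3 t2 s2 ->
    exec (Seq c1 c2) st1 st3 (t1 + t2) (maxn s1 s2)
| ExecIf e c1 c2 st st' t s :
    exec (if eval st e != 0 then c1 else c2) st st' t s ->
    exec (If e c1 c2) st st' ((ecost e).+1 + t) s
| ExecWhileStop e c st :
    eval st e = 0 ->
    exec (While e c) st st (ecost e).+1 (space st)
| ExecWhileLoop e c st1 st2 st3 t1 t2 s1 s2 :
    eval st1 e != 0 ->
    exec c st1 st2 t1 s1 -> exec (While e c) st2 st3 t2 s2 ->
    exec (While e c) st1 st3 ((ecost e).+1 + t1 + t2) (maxn s1 s2).

Lemma exec_det c st st1 st2 t1 t2 s1 s2 :
  exec c st st1 t1 s1 -> exec c st st2 t2 s2 ->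
  [/\ st1 = st2, t1 = t2 & s1 = s2].
Proof.
move=> H; elim: H st2 t2 s2 => {c st st1 t1 s1}.
- by move=> st st2 t2 s2 H; inversion H; subst.
- by move=> x e st st' st2 t2 s2 H; inversion H; subst.
- by move=> a e1 e2 st lt st' st2 t2 s2 H; inversion H; subst.
- by move=> a e st st' st2 t2 s2 H; inversion H; subst.
- move=> c1 c2 sta stb stc ta tb sa sb _ IH1 _ IH2 st2 t2 s2 H.
  inversion H as [| | | |? ? ? stm ? ? ? ? ? E1 E2| | |]; subst.
  have [? ? ?] := IH1 _ _ _ E1; subst.
  by have [? ? ?] := IH2 _ _ _ E2; subst.
- move=> e c1 c2 st st' t s _ IH st2 t2 s2 H.
  inversion H as [| | | | |? ? ? ? ? ? ? E| |]; subst.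
  by have [? ? ?] := IH _ _ _ E; subst.
- move=> e c st e0 st2 t2 s2 H; inversion H; subst => //.
  by match goal with ne : is_true (_ != 0) |- _ => move: ne; rewrite e0 end.
- move=> e c sta stb stc ta tb sa sb ne _ IH1 _ IH2 st2 t2 s2 H.
  inversion H as [| | | | | |? ? ? E0|? ? ? stm ? ? ? ? ? _ E1 E2]; subst.
    by move: ne; rewrite E0.
  have [? ? ?] := IH1 _ _ _ E1; subst.
  by have [? ? ?] := IH2 _ _ _ E2; subst.
Qed.

Definition block (cs : seq cmd) : cmd := foldr Seq Skip cs.

Declare Scope ram_scope.
Delimit Scope ram_scope with ram.
Bind Scope ram_scope with expr.
Infix "+" := Add : ram_scope.
Infix "-" := Sub : ram_scope.
Notation "# k" := (Cst k) (at level 5, format "# k") : ram_scope.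
Notation "$ x" := (Reg x) (at level 5, format "$ x") : ram_scope.

Definition rW := 0.
Definition rT := 1.
Definition rN := 2.
Definition rL := 3.
Definition rI := 4.
Definition rK := 5.
Definition rM := 6.
Definition rC := 7.

Definition aB := 0.
Definition aPad := 1.
Definition aStar := 2.
Definition aX := 3.
Definition aY := 4.
Definition aBit := 5.
Definition aU := 6.
Definition aV := 7.
Definition aOut := 8.

Definition incr (x : nat) : cmd := Set_ x ($x + #1).

Definition for_up (e : expr) (body : seq cmd) : cmd :=
  block [:: Set_ rI #0; While (e - $rI) (block (body ++ [:: incr rI]))].

(* Bits are stored as 0/1, and positions 1..n' are stored in cells 0..n'-1. *)

Definition binary_representation : cmd := block
  [:: Set_ rT $rW;
      Set_ rN #0;
      While $rT (block [:: Set_ rT (Half $rT); incr rN]);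
      New aB $rN;
      Set_ rT $rW;
      Set_ rI $rN;
      While $rI (block
        [:: Set_ rI ($rI - #1);
            Store aB $rI (Odd $rT);
            Set_ rT (Half $rT)])].

Definition pad_and_flip : cmd := block
  [:: Set_ rL ($rN + $rN + #1);
      New aPad $rL;
      for_up $rN [:: Store aPad ($rN + $rI) (Cell aB $rI)];
      Store aPad ($rL - #1) #1;
      New aStar $rL;
      for_up $rL [:: Store aStar $rI (#1 - Cell aPad $rI)]].

Definition split_positions : cmd := block
  [:: New aX $rL;
      New aY $rL;
      Set_ rK #0;
      Set_ rM #0;
      for_up $rL
        [:: If (Cell aStar $rI)
              (block [:: Store aY $rM ($rI + #1); incr rM])
              (block [:: Store aX $rK ($rI + #1); incr rK])]].

Definition make_bitonic : cmd := block
  [:: New aBit $rL;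
      for_up $rK [:: Store aBit $rI (Cell aX $rI)];
      for_up $rM [:: Store aBit ($rK + $rI) (Cell aY ($rM - #1 - $rI))]].

(* The 2-cycles are the pairs (U[i], V[i]); the 1-cycle is in register [rC]. *)
Definition make_cycles : cmd := block
  [:: New aU $rN;
      New aV $rN;
      for_up $rN
        [:: Store aU $rI (Cell aBit $rI);
            Store aV $rI (Cell aBit ($rL - #1 - $rI))];
      Set_ rC (Cell aBit $rN)].

Definition output_permutation : cmd := block
  [:: New aOut $rL;
      for_up $rN
        [:: Store aOut (Cell aU $rI - #1) (Cell aV $rI);
            Store aOut (Cell aV $rI - #1) (Cell aU $rI)];
      Store aOut ($rC - #1) $rC].

Definition encode_W_to_SIP : cmd := block
  [:: binary_representation; pad_and_flip; split_positions; make_bitonic;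
      make_cycles; output_permutation].

(* The input integer is one word, from which the program extracts the bits. *)
Definition input (w : nat) : state := State [:: w] [::].

Definition encodes (w : nat) (p : seq nat) (t s : nat) : Prop :=
  exists2 st, exec encode_W_to_SIP (input w) st t s & array st aOut = p.

(* Main.v *)
(** The [n] leading zeros of [0^n B 1] become ones after flipping, so the
    bitonic sequence ends in [n, ..., 1]; mirroring it around its centre
    therefore sends [i] to its [i]-th item for [i <= n], and the permutation
    determines the whole bitonic sequence.  The positions of the zeros are the
    prefix of that sequence up to its maximum [2n+1] (the flipped final 1),
    which gives back [B].  The time bound comes from running the program
    symbolically, every loop having an explicit state after [i] iterations;
    space is bounded by time, since a step of cost [t] can only add [O(t)] words. *)

Require Import Defs.
From mathcomp Require Import all_boot.
From mathcomp Require Import zify.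

(** * Executing the machine *)

(* One more than the largest register or array that [c] can create: writing it
   may pad the state with up to [width c] words. *)
Fixpoint width (c : cmd) : nat :=
  match c with
  | Skip | Store _ _ _ => 0
  | Set_ x _ => x.+1
  | New a _ => a.+1
  | Seq c1 c2 | If _ c1 c2 => maxn (width c1) (width c2)
  | While _ c1 => width c1
  end.

(** Writing past the end of the heap pads it with at most [a] empty arrays, each of which costs one
    descriptor word. *)
Lemma sumn_set_nth (h : seq (seq nat)) a (s : seq nat) :
  sumn [seq (size u).+1 | u <- set_nth [::] h a s] <=
    sumn [seq (size u).+1 | u <- h] + (a + (size s).+1).
Proof.
elim: h a => [|u h IH] [|a] /=; try by lia.
  by elim: a => [|a] /=; lia.
by move: (IH a); lia.
Qed.

Lemma sumn_set_nth_same_size (h : seq (seq nat)) a (s : seq nat) :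
  size s = size (nth [::] h a) -> a < size h ->
  sumn [seq (size u).+1 | u <- set_nth [::] h a s] =
    sumn [seq (size u).+1 | u <- h].
Proof.
elim: h a => [|u h IH] [|a] //= es lt; first by rewrite es.
by rewrite IH.
Qed.

(** A single step adds at most [width c] words, plus, for [New], cells that are paid for one by one.
    A time bound therefore yields a bound on peak space. *)
Lemma exec_space c st st' t s : exec c st st' t s ->
  space st' <= space st + width c * t /\ s <= space st + width c * t.
Proof.
elim=> {c st st' t s} /=.
- by move=> st; lia.
- move=> x e st; rewrite /space /= size_set_nth.
  have: x.+1 <= x.+1 * (ecost e).+1 by rewrite leq_pmulr.
  by lia.
- move=> a e1 e2 st lt.
  (* An absent array reads as empty, so a successful store hits an existing array and leaves all
     sizes unchanged. *)
  have lta : a < size (heap st).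
    by rewrite ltnNge; apply: contraTN lt => le; rewrite /array nth_default.
  rewrite /space /= sumn_set_nth_same_size //; first by lia.
  by rewrite size_set_nth; apply/maxn_idPr.
- move=> a e st; rewrite /space /=.
  have := sumn_set_nth (heap st) a (nseq (eval st e) 0); rewrite size_nseq.
  nia.
- by move=> c1 c2 st1 st2 st3 t1 t2 s1 s2 _ [? ?] _ [? ?]; nia.
- by move=> e c1 c2 st st' t s _; case: ifP => _ [? ?]; nia.
- by move=> e c st _; lia.
- by move=> e c st1 st2 st3 t1 t2 s1 s2 _ _ [? ?] _ [? ?]; nia.
Qed.

(** * Time-bounded execution and loop rules *)

(** Exact time and peak space are hidden so that bounds compose; [exec_space] recovers the space at
    the end. *)
Definition runs (c : cmd) (st st' : state) (T : nat) : Prop :=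
  exists t s, exec c st st' t s /\ t <= T.

Lemma runs_weaken c st st1 st2 T1 T2 :
  runs c st st1 T1 -> st1 = st2 -> T1 <= T2 -> runs c st st2 T2.
Proof.
by move=> [t [s [E le]]] <- le2; exists t, s; split=> //; apply: leq_trans le2.
Qed.

Lemma runs_skip st : runs Skip st st 1.
Proof. by exists 1, (space st); split=> //; constructor. Qed.

Lemma runs_set x e st :
  runs (Set_ x e) st (set_reg st x (eval st e)) (ecost e).+1.
Proof. by do 2 eexists; split; [constructor|]. Qed.

Lemma runs_store a e1 e2 st :
  eval st e1 < size (array st a) ->
  runs (Store a e1 e2) st
    (set_array st a (set_nth 0 (array st a) (eval st e1) (eval st e2)))
    (ecost e1 + ecost e2).+1.
Proof. by move=> lt; do 2 eexists; split; [constructor|]. Qed.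

Lemma runs_new a e st :
  runs (New a e) st (set_array st a (nseq (eval st e) 0))
    (ecost e + eval st e).+1.
Proof. by do 2 eexists; split; [constructor|]. Qed.

Lemma runs_seq c1 c2 st1 st2 st3 T1 T2 :
  runs c1 st1 st2 T1 -> runs c2 st2 st3 T2 ->
  runs (Seq c1 c2) st1 st3 (T1 + T2).
Proof.
move=> [t1 [s1 [E1 le1]]] [t2 [s2 [E2 le2]]].
by do 2 eexists; split; [econstructor; eauto | exact: leq_add].
Qed.

Lemma runs_if e c1 c2 st st' T :
  runs (if eval st e != 0 then c1 else c2) st st' T ->
  runs (If e c1 c2) st st' ((ecost e).+1 + T).
Proof.
move=> [t [s [E le]]].
by do 2 eexists; split; [constructor; eauto | rewrite leq_add2l].
Qed.

(** The invariant is a sequence of explicit states. Induction peels off the first iteration and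
    continues with the shifted sequence. *)
Lemma runs_while e c (st : nat -> state) n T :
  (forall i, i < n -> eval (st i) e != 0) -> eval (st n) e = 0 ->
  (forall i, i < n -> runs c (st i) (st i.+1) T) ->
  runs (While e c) (st 0) (st n) (n * (T + (ecost e).+1) + (ecost e).+1).
Proof.
elim: n st => [|n IH] st ne0 e0 body.
  by do 2 eexists; split; [apply: ExecWhileStop | rewrite mul0n].
have [t1 [s1 [E1 le1]]] := body 0 isT.
have [||t2 [s2 [E2 le2]]] := IH (fun i => st i.+1) _ e0.
- by move=> i lt; apply: ne0.
- by move=> i lt; apply: body.
exists ((ecost e).+1 + t1 + t2), (maxn s1 s2); split; last by lia.
by apply: ExecWhileLoop E1 E2; apply: ne0.
Qed.

(** Each test of [e - $rI] costs [ecost e + 3]; resetting the counter and the closing [Skip] add 3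
    more to the final test. *)
Lemma runs_for_up e body (st : nat -> state) st0 n T :
  set_reg st0 rI 0 = st 0 ->
  (forall i, i <= n -> eval (st i) (e - $rI)%ram = n - i) ->
  (forall i, i < n -> runs (block (body ++ [:: incr rI])) (st i) (st i.+1) T) ->
  runs (for_up e body) st0 (st n) (n * (T + (ecost e + 3)) + (ecost e + 6)).
Proof.
move=> st0E cond run.
apply: (runs_weaken _ _ _ _
  (2 + (n * (T + (ecost (e - $rI)%ram).+1) + (ecost (e - $rI)%ram).+1 + 1))) => //;
  last by rewrite /=; nia.
apply: runs_seq; first exact: runs_set.
apply: runs_seq; last exact: runs_skip.
rewrite [set_reg _ _ _]st0E; apply: runs_while => // [i lt|].
  by rewrite cond ?(ltnW lt) // -lt0n subn_gt0.
by rewrite cond // subnn.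
Qed.

Lemma block_cons c cs : block (c :: cs) = Seq c (block cs).
Proof. by []. Qed.

(* An array of length [L] filled with [s] so far, the rest still being zero. *)
Definition pref (L : nat) (s : seq nat) : seq nat := s ++ nseq (L - size s) 0.

Lemma size_pref L s : size s <= L -> size (pref L s) = L.
Proof. by move=> le; rewrite size_cat size_nseq subnKC. Qed.

Lemma pref_nil L : pref L [::] = nseq L 0.
Proof. by rewrite /pref subn0. Qed.

Lemma pref_full s : pref (size s) s = s.
Proof. by rewrite /pref subnn cats0. Qed.

Lemma pref_take_full k s : size s = k -> pref k (take k s) = s.
Proof. by move=> <-; rewrite take_size pref_full. Qed.

Lemma nth_pref L s i : nth 0 (pref L s) i = nth 0 s i.
Proof.
rewrite nth_cat; case: ltnP => // le.
by rewrite nth_nseq if_same nth_default.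
Qed.

Lemma set_nth_pref L s x : size s < L ->
  set_nth 0 (pref L s) (size s) x = pref L (rcons s x).
Proof.
rewrite /pref => lt; have -> : L - size s = (L - size (rcons s x)).+1.
  by rewrite size_rcons; lia.
rewrite -cats1 -catA /=; move: (nseq _ _) => r.
by elim: s {lt} => //= y s ->.
Qed.

(** Invariant step of the loops that fill an array from left to right. *)
Lemma set_nth_pref_take L s i : i < size s -> size s <= L ->
  set_nth 0 (pref L (take i s)) i (nth 0 s i) = pref L (take i.+1 s).
Proof.
move=> lt le; rewrite (take_nth 0) // -set_nth_pref; rewrite size_takel //; lia.
Qed.

(** Counterpart for the bit array, which is filled from its last cell backwards. *)
Lemma set_nth_last_zero k x (s : seq nat) :
  set_nth 0 (nseq k.+1 0 ++ s) k x = nseq k 0 ++ x :: s.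
Proof. by elim: k => //= k ->. Qed.

(** * Values of bit strings *)

Definition value (B : seq bool) : nat :=
  \sum_(i < size B) nth false B i * 2 ^ (size B - i.+1).

Lemma value_rcons B b : value (rcons B b) = (value B).*2 + b.
Proof.
rewrite /value size_rcons big_ord_recr /= subnn muln1 nth_rcons ltnn eqxx.
congr (_ + _); rewrite -mul2n big_distrr /=; apply: eq_bigr => i _.
rewrite nth_rcons ltn_ord mulnCA -expnS; congr (_ * 2 ^ _).
by have := ltn_ord i; lia.
Qed.

(** Halving drops the last bit, so the successive halves of the input are the values of the prefixes
    of [B]. *)
Lemma value_take B i : i < size B ->
  value (take i.+1 B) = (value (take i B)).*2 + nth false B i.
Proof. by move=> lt; rewrite (take_nth false) // value_rcons. Qed.

(** Every nonempty prefix keeps the leading one, so the loop that counts bits stops after exactly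
    [size B] halvings. *)
Lemma value_gt0 B : head false B -> 0 < value B.
Proof.
elim/last_ind: B => // B b IH; rewrite value_rcons.
case: B IH => [_ /= ->|a B IH /= hB]; first by rewrite addn1.
by have := IH hB; lia.
Qed.

(** Strong induction: the parity of [w] is appended to a representation of its half. *)
Lemma binary_repr_exists w : 0 < w -> exists B, binary_repr w B.
Proof.
elim/ltn_ind: w => w IH w0.
have [w1|w1] := leqP w 1.
  exists [:: true]; split=> //.
  by rewrite big_ord1 subnn muln1 /=; lia.
have [||B [hB wB]] := IH w./2; [lia..|].
exists (rcons B (odd w)); split; first by case: B hB {wB}.
by rewrite -/(value _) value_rcons /value -wB addnC odd_double_half.
Qed.

(** * The encoding permutation *)

Lemma size_padded B : size (padded B) = 2 * size B + 1.
Proof. by rewrite !size_cat size_nseq /=; lia. Qed.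

(** * Positions of bits and the bitonic sequence *)

Lemma positions_rcons v S b :
  positions v (rcons S b) =
    positions v S ++ (if b == v then [:: (size S).+1] else [::]).
Proof.
rewrite /positions size_rcons -[(size S).+1]addn1 iotaD filter_cat /= nth_rcons addn1.
rewrite ltnn eqxx /=; congr (_ ++ _).
apply: eq_in_filter => i; rewrite mem_iota => lt.
by rewrite nth_rcons (_ : i.-1 < size S) //; lia.
Qed.

Lemma positions_cat v S1 S2 :
  exists T, positions v (S1 ++ S2) = positions v S1 ++ T.
Proof.
elim/last_ind: S2 => [|S2 b [T TE]]; first by exists [::]; rewrite !cats0.
rewrite -rcons_cat positions_rcons TE -catA; by eexists.
Qed.

Lemma positions_nseq v n : positions v (nseq n v) = iota 1 n.
Proof.
rewrite /positions size_nseq; apply/all_filterP/allP => i.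
rewrite mem_iota nth_nseq => lt; rewrite (_ : i.-1 < n) //; lia.
Qed.

Lemma size_positions v S : size (positions v S) = count (pred1 v) S.
Proof.
elim/last_ind: S => // S b IH; rewrite positions_rcons size_cat IH.
by rewrite -cats1 count_cat /= addn0; case: (b == v).
Qed.

Lemma mem_positions v S i :
  i < size S -> (i.+1 \in positions v S) = (nth false S i == v).
Proof. by move=> lt; rewrite mem_filter mem_iota /= add1n ltnS lt andbT. Qed.

(** The two lists of positions are complementary filters of one interval, and reversing one of them
    does not affect the multiset. *)
Lemma perm_bitonic S : perm_eq (bitonic S) (iota 1 (size S)).
Proof.
rewrite /bitonic perm_sym -(perm_filterC (fun i => nth false S i.-1 == false)).
rewrite perm_cat2l perm_sym perm_rev.
rewrite (_ : [seq x <- _ | _] = positions true S) //.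
by apply: eq_filter => i /=; case: nth.
Qed.

(** * Reflecting a permutation about its centre *)

Definition mirror (pb : seq nat) (x : nat) : nat :=
  nth 0 pb (size pb - (index x pb).+1).

Definition mirror_perm (pb : seq nat) : seq nat :=
  mkseq (fun j => mirror pb j.+1) (size pb).

Section Mirror.
Variables (m : nat) (pb : seq nat).
Hypothesis pbP : perm_eq pb (iota 1 m).

Lemma size_one_line : size pb = m.
Proof. by rewrite (perm_size pbP) size_iota. Qed.

Lemma uniq_one_line : uniq pb.
Proof. by rewrite (perm_uniq pbP) iota_uniq. Qed.

Lemma mem_one_line x : (x \in pb) = (0 < x <= m).
Proof. by rewrite (perm_mem pbP) mem_iota; lia. Qed.

Lemma nth_one_line i : i < m -> 0 < nth 0 pb i <= m.
Proof. by move=> lt; rewrite -mem_one_line mem_nth // size_one_line. Qed.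

Lemma mirror_nth i : i < m -> mirror pb (nth 0 pb i) = nth 0 pb (m - i.+1).
Proof.
by move=> lt; rewrite /mirror index_uniq ?uniq_one_line ?size_one_line.
Qed.

Lemma mem_mirror x : 0 < x <= m -> 0 < mirror pb x <= m.
Proof. by move=> xm; apply: nth_one_line; rewrite size_one_line; lia. Qed.

(** The reflection of 0-based indices, [i] to [m - i.+1], is its own inverse. *)
Lemma mirrorK x : 0 < x <= m -> mirror pb (mirror pb x) = x.
Proof.
move=> xm; have xpb : x \in pb by rewrite mem_one_line.
have := xpb; rewrite -index_mem size_one_line => lt.
rewrite {2}/mirror size_one_line mirror_nth; last by lia.
by rewrite -[RHS](nth_index 0 xpb); congr nth; lia.
Qed.

Lemma item_mirror_perm x : 0 < x <= m -> item (mirror_perm pb) x = mirror pb x.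
Proof.
move=> xm; rewrite /item nth_mkseq ?size_one_line; last by lia.
by rewrite prednK //; case/andP: xm.
Qed.

(** An involution is injective, and an injective map of [[1 .. m]] into itself is a permutation by
    counting. *)
Lemma mirror_perm_self_inverting : self_inverting_perm m (mirror_perm pb).
Proof.
split=> [|i im]; last by rewrite !item_mirror_perm ?mem_mirror ?mirrorK.
have sz : size (mirror_perm pb) = m by rewrite size_mkseq size_one_line.
have inj : {in iota 1 m &, injective (mirror pb)}.
  move=> x y; rewrite !mem_iota => xm ym E.
  by rewrite -[x]mirrorK ?E ?mirrorK //; lia.
have E : mirror_perm pb = map (mirror pb) (iota 1 m).
  by rewrite /mirror_perm size_one_line /mkseq (iotaDl 1 0) -map_comp.
have un : uniq (mirror_perm pb) by rewrite E map_inj_in_uniq ?iota_uniq.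
apply: uniq_perm; rewrite ?iota_uniq //; apply: (uniq_min_size un _ _).2.
  move=> x; rewrite E => /mapP [y]; rewrite mem_iota => ym ->.
  by have := mem_mirror y; rewrite mem_iota; lia.
by rewrite sz size_iota.
Qed.

Lemma mirror_perm_has_cycles n :
  m = 2 * n + 1 -> has_cycles n pb (mirror_perm pb).
Proof.
move=> mE; split; first by rewrite size_mkseq size_one_line.
- move=> i im.
  have H j : 0 < j <= m -> item (mirror_perm pb) (item pb j) = item pb (m.+1 - j).
    move=> jm; rewrite item_mirror_perm; last by apply: nth_one_line; lia.
    rewrite /item mirror_nth; last by lia.
    by congr nth; lia.
  by split; rewrite H; try (congr item); lia.
- rewrite item_mirror_perm; last by apply: nth_one_line; lia.
  rewrite /item mirror_nth; last by lia.
  by congr nth; lia.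
Qed.

End Mirror.

(** * Recovering the bits from the permutation *)

Definition encoded_bits (B : seq bool) : seq bool := flip (padded B).
Definition encoded_bitonic (B : seq bool) : seq nat := bitonic (encoded_bits B).

Lemma size_encoded_bits B : size (encoded_bits B) = 2 * size B + 1.
Proof. by rewrite size_map size_padded. Qed.

Lemma perm_encoded_bitonic B :
  perm_eq (encoded_bitonic B) (iota 1 (2 * size B + 1)).
Proof. by rewrite -size_encoded_bits perm_bitonic. Qed.

Lemma encoded_bitsE B :
  encoded_bits B = rcons (nseq (size B) true ++ map negb B) false.
Proof. by rewrite /encoded_bits /flip !map_cat map_nseq /= catA cats1. Qed.

(* The leading zeros of the padded string put [1 .. n] first among the positions
   of ones, hence last, in decreasing order, in the bitonic sequence. *)
Lemma encoded_bitonic_tail B :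
  exists q, encoded_bitonic B = q ++ rev (iota 1 (size B)).
Proof.
rewrite /encoded_bitonic /bitonic encoded_bitsE -cats1 -catA.
have [T ->] := positions_cat true (nseq (size B) true) (map negb B ++ [:: false]).
by rewrite positions_nseq rev_cat catA; eexists.
Qed.

Lemma encoded_bitonic_inj B1 B2 :
  size B1 = size B2 -> encoded_bitonic B1 = encoded_bitonic B2 -> B1 = B2.
Proof.
move=> eqn eqpb.
have posE B : positions false (encoded_bits B) =
    take (index (2 * size B + 1) (encoded_bitonic B)).+1 (encoded_bitonic B).
  rewrite /encoded_bitonic /bitonic encoded_bitsE positions_rcons /=.
  set P := positions _ _; set R := rev _.
  have szE : (size (nseq (size B) true ++ [seq ~~ i | i <- B])).+1 = 2 * size B + 1.
    by rewrite size_cat size_nseq size_map; lia.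
  (* The final zero has the largest position, so its first occurrence marks the end of the list of
     zeros. *)
  have notin : 2 * size B + 1 \notin P.
    rewrite mem_filter mem_iota size_cat size_nseq size_map.
    by apply/negP => /andP [_]; lia.
  rewrite szE -catA index_cat (negbTE notin) /= eqxx addn0.
  by rewrite cats1 -cat_rcons take_size_cat ?size_rcons.
have posEE : positions false (encoded_bits B1) = positions false (encoded_bits B2).
  by rewrite !posE eqpb eqn.
have bitsE : encoded_bits B1 = encoded_bits B2.
  apply: (@eq_from_nth _ false); first by rewrite !size_encoded_bits eqn.
  move=> i lt1; have lt2 : i < size (encoded_bits B2).
    by rewrite size_encoded_bits -eqn -size_encoded_bits.
  (* A bit is zero exactly when its position is listed, so equal lists force equal bits. *)
  have := mem_positions false _ _ lt1; rewrite posEE mem_positions //.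
  by do 2 case: nth.
have : padded B1 = padded B2 by move/(inj_map negb_inj): bitsE.
rewrite /padded eqn => /eqP; rewrite eqseq_cat // eqxx /= eqseq_cat //.
by case/andP => /eqP.
Qed.

Lemma mirror_perm_encoded_inj B1 B2 :
  mirror_perm (encoded_bitonic B1) = mirror_perm (encoded_bitonic B2) ->
  B1 = B2.
Proof.
move=> eqp.
have eqn : size B1 = size B2.
  have := congr1 size eqp; rewrite !size_mkseq.
  by rewrite !(size_one_line _ _ (perm_encoded_bitonic _)); lia.
apply: encoded_bitonic_inj => //.
(* The first [size B] entries of the permutation and the known tail give the whole bitonic sequence
   except its middle item [c]. *)
have split_pb B : exists c, encoded_bitonic B =
    rcons (take (size B) (mirror_perm (encoded_bitonic B))) c ++ rev (iota 1 (size B)).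
  have pbP := perm_encoded_bitonic B; have szpb := size_one_line _ _ pbP.
  have [q qE] := encoded_bitonic_tail B.
  have szq : size q = (size B).+1.
    by move: szpb; rewrite qE size_cat size_rev size_iota; lia.
  case/lastP: q szq qE => // q c; rewrite size_rcons => -[szq] qE.
  exists c; rewrite {1}qE; congr (rcons _ c ++ _).
  apply: (@eq_from_nth _ 0).
    by rewrite size_takel // size_mkseq szpb; lia.
  move=> i; rewrite szq => lt; rewrite nth_take // nth_mkseq; last by rewrite szpb; lia.
  (* The decreasing tail places [i.+1] opposite index [i], so its mirror image is the item at index
     [i]. *)
  have -> : i.+1 = nth 0 (encoded_bitonic B) (2 * size B + 1 - i.+1).
    rewrite qE nth_cat size_rcons szq ifF; last by lia.
    rewrite nth_rev size_iota ?nth_iota; lia.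
  rewrite (mirror_nth _ _ pbP); last by lia.
  rewrite (_ : _ - _ = i); last by lia.
  by rewrite qE nth_cat nth_rcons size_rcons szq lt ifT //; lia.
have [c1 E1] := split_pb B1; have [c2 E2] := split_pb B2.
(* Both sequences permute the same interval and agree outside the middle, so the middle items agree
   too. *)
move: (perm_encoded_bitonic B1) (perm_encoded_bitonic B2).
rewrite E1 E2 eqp -eqn => /perm_trans H; rewrite perm_sym => /H.
set q := take _ _.
rewrite perm_cat2r -!cats1 perm_cat2l => /perm_small_eq -> //.
Qed.

(** * Running the encoder *)

Ltac unfold_names :=
  rewrite /rW /rT /rN /rL /rI /rK /rM /rC
    /aB /aPad /aStar /aX /aY /aBit /aU /aV /aOut.
Ltac simp := rewrite /set_reg /set_array /array /=.
Ltac step :=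
  eapply runs_seq;
  [ first [exact: runs_set | exact: runs_new | apply: runs_store; simp; try lia]
  | simp ].

(** The output array is written in scattered order, so it is described cell by cell rather than by a
    filled prefix. *)
Lemma set_nth_mkseq f m k x : k < m ->
  set_nth 0 (mkseq f m) k x = mkseq (fun j => if j == k then x else f j) m.
Proof.
move=> lt; apply: (@eq_from_nth _ 0) => [|i].
  by rewrite size_set_nth !size_mkseq; apply/maxn_idPr.
rewrite size_set_nth size_mkseq (maxn_idPr lt) => lti.
by rewrite nth_set_nth /= !nth_mkseq.
Qed.

(** * The phases of the program, each with its explicit final state *)

Section Phases.
Variable B : seq bool.
Hypothesis B_head : head false B.
Let n := size B.
Let L := 2 * n + 1.
Let w := value B.
Let Bn : seq nat := map nat_of_bool B.
Let Pn : seq nat := map nat_of_bool (padded B).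
Let S := encoded_bits B.
Let Sn : seq nat := map nat_of_bool S.
Let X := positions false S.
Let Y := positions true S.
Let pb := encoded_bitonic B.

Lemma runs_binary_representation :
  runs binary_representation (input w)
    (State [:: w; 0; n; 0; 0] [:: Bn]) (30 * n + 30).
Proof.
rewrite /binary_representation /input ?block_cons; unfold_names.
eapply runs_weaken.
- step. step.
  eapply runs_seq.
    (* After [i] halvings the work register holds the value of the first [n - i] bits. *)
    pose st i := State [:: w; value (take (n - i) B); i] [::].
    rewrite (_ : State _ _ = st 0); last by rewrite /st subn0 take_size.
    apply: (runs_while _ _ st n) => [i lt||i lt].
    - rewrite /= -lt0n; apply: value_gt0.
      have -> : n - i = (n - i.+1).+1 by lia.
      by move: (n - _) => k; case: (B) B_head.
    - by rewrite /= subnn take0 /value big_ord0.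
    - rewrite ?block_cons.
      eapply runs_weaken; [step; step; exact: runs_skip | | apply: leqnn].
      rewrite /st /=; congr (State [:: _; _; _] _); last by rewrite addn1.
      have -> : n - i = (n - i.+1).+1 by lia.
      by rewrite value_take; [case: nth; lia | rewrite /n; lia].
  simp. step. step. step.
  eapply runs_seq.
    pose st i := State [:: w; value (take (n - i) B); n; 0; n - i]
      [:: nseq (n - i) 0 ++ drop (n - i) Bn].
    rewrite (_ : State _ _ = st 0); last first.
      by rewrite /st subn0 take_size drop_oversize ?cats0 // size_map.
    apply: (runs_while _ _ st n) => [i lt||i lt].
    - by rewrite /= -lt0n; lia.
    - by rewrite /= subnn.
    - rewrite ?block_cons.
      have e : n - i = (n - i.+1).+1 by lia.
      have lt' : n - i.+1 < size B by rewrite /n; lia.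
      eapply runs_weaken; [step; step; [|step; exact: runs_skip] | | apply: leqnn].
        by rewrite size_cat size_nseq size_drop size_map; lia.
      rewrite /st /= e value_take // subn1 /=.
      congr (State [:: _; _; _; _; _] [:: _]); first by case: nth; lia.
      rewrite [drop (n - i.+1) _](drop_nth 0) ?size_map // (nth_map false) //.
      rewrite oddD odd_double oddb addFb.
      exact: set_nth_last_zero.
  exact: runs_skip.
- by rewrite /= subnn take0 drop0 /value big_ord0.
- by rewrite /=; lia.
Qed.

Let size_Sn : size Sn = L. Proof. by rewrite size_map size_encoded_bits. Qed.
Let size_Pn : size Pn = L. Proof. by rewrite size_map size_padded. Qed.
Let PnE : Pn = nseq n 0 ++ Bn ++ [:: 1].
Proof. by rewrite /Pn !map_cat map_nseq. Qed.
Let size_Bn : size Bn = n. Proof. by rewrite size_map. Qed.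

Lemma runs_pad_and_flip :
  runs pad_and_flip (State [:: w; 0; n; 0; 0] [:: Bn])
    (State [:: w; 0; n; L; L] [:: Bn; Pn; Sn]) (100 * n + 100).
Proof.
rewrite /pad_and_flip ?block_cons; unfold_names.
eapply runs_weaken.
- step. rewrite (_ : n + n + 1 = L); last by rewrite /L; lia.
  step.
  eapply runs_seq.
    (* A fresh array is zero, so the [n] padding zeros are in place before the loop starts. *)
    pose st i := State [:: w; 0; n; L; i] [:: Bn; pref L (take (n + i) Pn)].
    apply: (runs_for_up _ _ st _ n) => [|i le|i lt].
    - simp; rewrite /st addn0 PnE take_size_cat ?size_nseq //.
      by rewrite /pref size_nseq -nseqD subnKC // /L; lia.
    - by [].
    - rewrite /incr /= ?block_cons; unfold_names.
      eapply runs_weaken; [step; [|step; exact: runs_skip] | | apply: leqnn].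
        by rewrite size_pref ?size_takel ?size_Pn /L; lia.
      rewrite /st /= addn1; congr (State _ [:: _; _]).
      have -> : nth 0 Bn i = nth 0 Pn (n + i).
        by rewrite PnE nth_cat size_nseq ltnNge leq_addr addKn nth_cat size_Bn lt.
      by rewrite addnS set_nth_pref_take // ?size_Pn /L; lia.
  simp.
  step; first by rewrite size_pref ?size_takel ?size_Pn /L; lia.
  rewrite (_ : set_nth _ _ _ _ = Pn); last first.
    have -> : 1 = nth 0 Pn (n + n).
      by rewrite PnE catA nth_cat size_cat size_nseq size_Bn ltnn subnn.
    (* The preceding rewrite also replaced the 1 in the index [L - 1]; this restores the index. *)
    rewrite (_ : L - nth 0 Pn (n + n) = n + n); last first.
      by rewrite PnE catA nth_cat size_cat size_nseq size_Bn ltnn subnn /= /L; lia.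
    rewrite set_nth_pref_take ?size_Pn /L; try lia.
    rewrite (_ : (n + n).+1 = size Pn) ?take_size; last by rewrite size_Pn /L; lia.
    by rewrite -/L -size_Pn pref_full.
  step.
  eapply runs_seq.
    pose st i := State [:: w; 0; n; L; i] [:: Bn; Pn; pref L (take i Sn)].
    apply: (runs_for_up _ _ st _ L) => [|i le|i lt].
    - by simp; rewrite /st take0 pref_nil.
    - by [].
    - rewrite /incr /= ?block_cons; unfold_names.
      eapply runs_weaken; [step; [|step; exact: runs_skip] | | apply: leqnn].
        by rewrite size_pref ?size_takel ?size_Sn; lia.
      rewrite /st /= addn1; congr (State _ [:: _; _; _]).
      (* On bits stored as 0 and 1, subtraction from 1 is complementation. *)
      have -> : 1 - nth 0 Pn i = nth 0 Sn i.
        have ltP : i < size (padded B) by rewrite size_padded.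
        rewrite (nth_map false) // (nth_map false) ?size_map //.
        by rewrite (nth_map false) //; case: nth.
      by rewrite set_nth_pref_take ?size_Sn.
  exact: runs_skip.
- by rewrite -size_Sn take_size pref_full.
- by rewrite /= /L; lia.
Qed.

Let P v i := positions v (take i S).

Let size_S : size S = L. Proof. exact: size_encoded_bits. Qed.

Let size_P v i : i <= L -> size (P v i) <= i.
Proof.
move=> le; rewrite size_positions; apply: leq_trans (count_size _ _) _.
by rewrite size_take size_S; case: ltnP.
Qed.

Let P_S v i : i < L ->
  P v i.+1 = if nth false S i == v then rcons (P v i) i.+1 else P v i.
Proof.
move=> lt; rewrite /P (take_nth false) ?size_S // positions_rcons.
rewrite size_takel ?size_S 1?ltnW //.
by case: ifP; rewrite ?cats1 ?cats0.
Qed.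

Lemma runs_split_positions :
  runs split_positions (State [:: w; 0; n; L; L] [:: Bn; Pn; Sn])
    (State [:: w; 0; n; L; L; size X; size Y]
       [:: Bn; Pn; Sn; pref L X; pref L Y])
    (200 * n + 200).
Proof.
rewrite /split_positions ?block_cons; unfold_names.
eapply runs_weaken.
- step. step. step. step.
  eapply runs_seq.
    pose st i := State [:: w; 0; n; L; i; size (P false i); size (P true i)]
      [:: Bn; Pn; Sn; pref L (P false i); pref L (P true i)].
    apply: (runs_for_up _ _ st _ L) => [|i le|i lt].
    - by simp; rewrite /st /P take0 /positions /= pref_nil.
    - by [].
    - rewrite /incr /= ?block_cons; unfold_names.
      have lev v : size (P v i) < L.
        by apply: (leq_ltn_trans _ lt); apply: size_P; apply: ltnW.
      (* The common state reached by both branches, before the loop counter advances. *)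
      pose st' := State [:: w; 0; n; L; i; size (P false i.+1); size (P true i.+1)]
        [:: Bn; Pn; Sn; pref L (P false i.+1); pref L (P true i.+1)].
      have -> : st i.+1 = set_reg st' 4 (i + 1) by rewrite addn1.
      apply: (runs_seq _ _ _ st' _ 20 5); last first.
        by apply: (runs_seq _ _ _ _ _ 4 1); [exact: runs_set | exact: runs_skip].
        apply: (runs_weaken _ _ st' _ (3 + 17) 20) => //.
        apply: runs_if; rewrite /= (nth_map false) ?size_S // eqb0 negbK.
        case E: (nth false S i) => /=; rewrite ?block_cons.
        - eapply runs_weaken; [step; [|step; exact: runs_skip] | |by []].
            by rewrite size_pref // ltnW.
          by rewrite /st' !addn1 !P_S // E /= set_nth_pref // size_rcons.
        - eapply runs_weaken; [step; [|step; exact: runs_skip] | |by []].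
            by rewrite size_pref // ltnW.
          by rewrite /st' !addn1 !P_S // E /= set_nth_pref // size_rcons.
  exact: runs_skip.
- by rewrite /P -size_S take_size.
- by rewrite /= /L; lia.
Qed.

Let pb_perm : perm_eq pb (iota 1 L). Proof. exact: perm_encoded_bitonic. Qed.
Let size_pb : size pb = L. Proof. exact: size_one_line pb_perm. Qed.
Let pbE : pb = X ++ rev Y. Proof. by []. Qed.
Let size_XY : size X + size Y = L.
Proof. by rewrite -size_pb pbE size_cat size_rev. Qed.

Lemma runs_make_bitonic :
  runs make_bitonic
    (State [:: w; 0; n; L; L; size X; size Y]
       [:: Bn; Pn; Sn; pref L X; pref L Y])
    (State [:: w; 0; n; L; size Y; size X; size Y]
       [:: Bn; Pn; Sn; pref L X; pref L Y; pb])
    (100 * n + 100).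
Proof.
rewrite /make_bitonic ?block_cons; unfold_names.
eapply runs_weaken.
- step.
  eapply runs_seq.
    pose st i := State [:: w; 0; n; L; i; size X; size Y]
      [:: Bn; Pn; Sn; pref L X; pref L Y; pref L (take i X)].
    apply: (runs_for_up _ _ st _ (size X)) => [|i le|i lt].
    - by simp; rewrite /st take0 pref_nil.
    - by [].
    - rewrite /incr /= ?block_cons; unfold_names.
      eapply runs_weaken; [step; [|step; exact: runs_skip] | | apply: leqnn].
        by rewrite size_pref ?size_takel; lia.
      by rewrite /st /= addn1 nth_pref set_nth_pref_take //; lia.
  simp.
  eapply runs_seq.
    pose st i := State [:: w; 0; n; L; i; size X; size Y]
      [:: Bn; Pn; Sn; pref L X; pref L Y; pref L (take (size X + i) pb)].
    apply: (runs_for_up _ _ st _ (size Y)) => [|i le|i lt].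
    - by simp; rewrite /st addn0 pbE take_size_cat // take_size.
    - by [].
    - rewrite /incr /= ?block_cons; unfold_names.
      eapply runs_weaken; [step; [|step; exact: runs_skip] | | apply: leqnn].
        by rewrite size_pref ?size_takel ?size_pb; lia.
      rewrite /st /= addn1 nth_pref; congr (State _ [:: _; _; _; _; _; _]).
      (* Reading [Y] from its end produces [rev Y], the decreasing half of the bitonic sequence. *)
      have -> : nth 0 Y (size Y - 1 - i) = nth 0 pb (size X + i).
        rewrite pbE nth_cat ltnNge leq_addr addKn nth_rev //; congr nth; lia.
      by rewrite addnS set_nth_pref_take // size_pb; lia.
  exact: runs_skip.
- by rewrite size_XY -size_pb take_size pref_full.
- by rewrite /=; nia.
Qed.

Let U := take n pb.
Let V := take n (rev pb).
Let c := nth 0 pb n.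
Let nL : n < L. Proof. by rewrite /L; lia. Qed.
Let size_U : size U = n. Proof. by rewrite size_takel // size_pb ltnW. Qed.
Let size_V : size V = n.
Proof. by rewrite size_takel // size_rev size_pb ltnW. Qed.
Let nth_U i : i < n -> nth 0 U i = nth 0 pb i.
Proof. by move=> lt; rewrite nth_take. Qed.
Let nth_V i : i < n -> nth 0 V i = nth 0 pb (L - i.+1).
Proof. by move=> lt; rewrite nth_take // nth_rev size_pb //; lia. Qed.

Lemma runs_make_cycles :
  runs make_cycles
    (State [:: w; 0; n; L; size Y; size X; size Y]
       [:: Bn; Pn; Sn; pref L X; pref L Y; pb])
    (State [:: w; 0; n; L; n; size X; size Y; c]
       [:: Bn; Pn; Sn; pref L X; pref L Y; pb; U; V])
    (100 * n + 100).
Proof.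
rewrite /make_cycles ?block_cons; unfold_names.
eapply runs_weaken.
- step. step.
  eapply runs_seq.
    pose st i := State [:: w; 0; n; L; i; size X; size Y]
      [:: Bn; Pn; Sn; pref L X; pref L Y; pb; pref n (take i U); pref n (take i V)].
    apply: (runs_for_up _ _ st _ n) => [|i le|i lt].
    - by simp; rewrite /st !take0 pref_nil.
    - by [].
    - rewrite /incr /= ?block_cons; unfold_names.
      eapply runs_weaken; [step; [|step; [|step; exact: runs_skip]] | | apply: leqnn].
      + by rewrite size_pref ?size_takel ?size_U; lia.
      + by rewrite size_pref ?size_takel ?size_V ?size_rev ?size_pb; lia.
      rewrite /st /= addn1 -nth_U // subnAC subn1 -subnS -nth_V //.
      by rewrite !set_nth_pref_take ?size_U ?size_V.
  step. exact: runs_skip.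
- by rewrite !pref_take_full.
- by rewrite /=; nia.
Qed.

(* The output array after [i] iterations: the [i] outermost pairs of the bitonic
   sequence have been written. *)
Let out i := mkseq (fun j =>
  if (index j.+1 pb < i) || (L - i <= index j.+1 pb) then mirror pb j.+1 else 0) L.

(** Cell [j] holds the image of [j.+1], so a store addressed by item [i] of [pb] hits it exactly
    when [j.+1] is that item. *)
Let cellE i j : i < L -> j < L -> (j == nth 0 pb i - 1) = (index j.+1 pb == i).
Proof.
move=> lti ltj; have := nth_one_line _ _ pb_perm _ lti => pos.
have jpb : j.+1 \in pb by rewrite (mem_one_line _ _ pb_perm).
rewrite -[RHS](nth_uniq 0 _ _ (uniq_one_line _ _ pb_perm)) ?index_mem ?size_pb //.
by rewrite nth_index //; case/andP: pos; case: (nth 0 pb i) => // k; rewrite subn1.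
Qed.

Let mirrorE i j : index j.+1 pb = i -> mirror pb j.+1 = nth 0 pb (L - i.+1).
Proof. by move=> <-; rewrite /mirror size_pb. Qed.

Let index_lt j : j < L -> index j.+1 pb < L.
Proof. by move=> ltj; rewrite -size_pb index_mem (mem_one_line _ _ pb_perm). Qed.

Lemma runs_output_permutation :
  runs output_permutation
    (State [:: w; 0; n; L; n; size X; size Y; c]
       [:: Bn; Pn; Sn; pref L X; pref L Y; pb; U; V])
    (State [:: w; 0; n; L; n; size X; size Y; c]
       [:: Bn; Pn; Sn; pref L X; pref L Y; pb; U; V; mirror_perm pb])
    (100 * n + 100).
Proof.
have cell_lt i : i < L -> nth 0 pb i - 1 < L.
  by move=> lt; have := nth_one_line _ _ pb_perm _ lt; lia.
rewrite /output_permutation ?block_cons; unfold_names.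
eapply runs_weaken.
- step.
  eapply runs_seq.
    pose st i := State [:: w; 0; n; L; i; size X; size Y; c]
      [:: Bn; Pn; Sn; pref L X; pref L Y; pb; U; V; out i].
    apply: (runs_for_up _ _ st _ n) => [|i le|i lt].
    - simp; rewrite /st; congr (State _ [:: _; _; _; _; _; _; _; _; _]).
      apply: (@eq_from_nth _ 0); rewrite size_nseq ?size_mkseq // => j ltj.
      by rewrite nth_nseq ltj nth_mkseq // ltn0 subn0 leqNgt index_lt.
    - by [].
    - have ltL : i < L by lia.
      have ltL' : L - i.+1 < L by lia.
      rewrite /incr /= ?block_cons; unfold_names.
      eapply runs_weaken; [step; [|step; [|step; exact: runs_skip]] | | apply: leqnn].
      + by rewrite size_mkseq nth_U // cell_lt.
      + by rewrite size_set_nth size_mkseq nth_V // leq_max cell_lt ?orbT.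
      rewrite /st /= addn1 nth_U // nth_V //.
      rewrite !set_nth_mkseq ?cell_lt //.
      congr (State _ [:: _; _; _; _; _; _; _; _; _]).
      apply: (@eq_from_nth _ 0); rewrite !size_mkseq // => j ltj.
      rewrite !nth_mkseq // !cellE //.
      have ltd := index_lt _ ltj.
      (* Cell [j] is set by the second store (index [L - i.+1]), by the first (index [i]), or by
         neither, in which case its status does not change. *)
      case: eqP => [e|ne1].
        rewrite ifT; last by lia.
        by rewrite (mirrorE _ _ e); congr nth; lia.
      case: eqP => [e|ne2].
        by rewrite ifT ?(mirrorE _ _ e) //; lia.
      by congr (if _ then _ else _); lia.
  step.
    by rewrite size_mkseq cell_lt.
  exact: runs_skip.
- rewrite set_nth_mkseq ?cell_lt //.
  congr (State _ [:: _; _; _; _; _; _; _; _; _]).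
  apply: (@eq_from_nth _ 0); rewrite !size_mkseq ?size_pb // => j ltj.
  rewrite !nth_mkseq ?size_pb // cellE //.
  have ltd := index_lt _ ltj.
  (* After [n] rounds only the centre, index [n], is unwritten; it is its own reflection. *)
  case: eqP => [e|ne]; last by rewrite ifT //; lia.
  by rewrite (mirrorE _ _ e); congr nth; lia.
- by rewrite /=; nia.
Qed.

(** * Total cost of the encoder *)

Lemma encodes_mirror_perm :
  exists t s, [/\ encodes w (mirror_perm pb) t s, t <= 2000 * n & s <= 10 * 2000 * n].
Proof.
(* Positivity of [n] lets the multiple of [n] absorb the additive constants of the phases. *)
have n0 : 0 < n by rewrite /n; case: (B) B_head.
have : runs encode_W_to_SIP (input w)
    (State [:: w; 0; n; L; n; size X; size Y; c]
       [:: Bn; Pn; Sn; pref L X; pref L Y; pb; U; V; mirror_perm pb])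
    (2000 * n).
  rewrite /encode_W_to_SIP ?block_cons; eapply runs_weaken.
  - eapply runs_seq; first exact: runs_binary_representation.
    eapply runs_seq; first exact: runs_pad_and_flip.
    eapply runs_seq; first exact: runs_split_positions.
    eapply runs_seq; first exact: runs_make_bitonic.
    eapply runs_seq; first exact: runs_make_cycles.
    eapply runs_seq; first exact: runs_output_permutation.
    exact: runs_skip.
  - by [].
  - by lia.
move=> [t [s [E le]]]; exists t, s; split=> //; first by eexists; [exact: E|].
have [_] := exec_space _ _ _ _ _ E.
(* The largest name created is [aOut], numbered 8, and the input occupies one register. *)
by rewrite (_ : width _ = 9) // (_ : space _ = 1) //; lia.
Qed.

End Phases.

(** * Correctness, unique decoding and linear bounds *)

Theorem theorem1 :
  exists C : nat,
  forall (w : nat) (B : seq bool), 0 < w -> binary_repr w B ->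
  exists (p : seq nat) (t s : nat),
    [/\ encodes w p t s,
        encoding_of B p,
        self_inverting_perm (2 * size B + 1) p,
        (forall w' t' s' : nat, 0 < w' -> encodes w' p t' s' -> w' = w)
      & t <= C * size B /\ s <= C * size B].
Proof.
exists (10 * 2000) => w B _ [B_head ->].
have [t [s [enc le_t le_s]]] := encodes_mirror_perm B B_head.
have pbP := perm_encoded_bitonic B.
exists (mirror_perm (encoded_bitonic B)), t, s; split=> //.
- exact: mirror_perm_has_cycles pbP _ _.
- exact: mirror_perm_self_inverting.
(* By determinism any run on [w'] outputs the mirror permutation of its bits [B'], and injectivity
   then gives equal bits. *)
- move=> w' t' s' w'0 [st' E' out'].
  have [B' [B'_head w'E]] := binary_repr_exists w' w'0.
  have [t2 [s2 [[st2 E2 out2] _ _]]] := encodes_mirror_perm B' B'_head.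
  rewrite w'E in E' *; have [stE _ _] := exec_det E' E2.
  have /mirror_perm_encoded_inj -> // :
    mirror_perm (encoded_bitonic B') = mirror_perm (encoded_bitonic B).
  by rewrite -out2 -out' stE.
- by split=> //; lia.
Qed.
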